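(* Assume model $\mathcal{M}$ and run Algorithm $\mathcal{A}$, both described in the context. Then the expected total cost satisfies $E[G]=\sum_{t=1}^{r} s\cdot\overline{d}$, where $\overline{d}=\frac{1}{mn}\sum_{i=1}^{m}\sum_{j=1}^{n}d_{i,j}$.
   Context: Model $\mathcal{M}$: a complete bipartite graph with producers $P_1,\dots,P_m$ and consumers $C_1,\dots,C_n$, each consumer having the same capacity $c$ (a strict bound on its load), and edge distances $d_{i,j}\ge 0$ between $P_i$ and $C_j$. There are $r$ requests, arriving in rounds $t=1,\dots,r$, all of the same size $s$. It is assumed that every request can be assigned to at least one consumer that still has enough space (the number and size of requests are limited accordingly). Loads $\ell_j$ start at $0$. Algorithm $\mathcal{A}$: initialize $\ell_j=0$ for all $j$ and $G=0$. For $t=1,\dots,r$: choose a producer $P_i$ independently and uniformly at random from $[m]$; let $C(t)=\{j\in[n]:\ell_j+s\le c\}$; choose a consumer $j$ independently and uniformly at random from $C(t)$; set $\ell_j\gets\ell_j+s$ and $G\gets G+s\cdot d_{i,j}$. $G$ is the total cost. *)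

(* Defs.v *)
From HB Require Import structures.
From mathcomp Require Import all_boot all_order all_algebra.
Set Implicit Arguments.
Unset Strict Implicit.
Unset Printing Implicit Defensive.
Import Order.TTheory GRing.Theory Num.Theory.
Local Open Scope ring_scope.

(* Finitely supported distributions, as lists of (probability, outcome);
   normalization is not part of the type, see [total_mass_run]. *)
Section FiniteDistributions.
Variable R : realFieldType.

Definition distr (T : Type) : Type := seq (R * T).

Definition dret (T : Type) (x : T) : distr T := [:: (1, x)].

(* Run mu, then nu on its outcome x, with the random choices made in nu x
   independent of those made in mu. *)
Definition dbind (T U : Type) (mu : distr T) (nu : T -> distr U) : distr U :=
  flatten [seq [seq (w.1 * v.1, v.2) | v <- nu w.2] | w <- mu].

Definition duniform (T : finType) (A : {set T}) : distr T :=
  [seq (#|A|%:R^-1, x) | x <- enum A].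

Definition expectation (T : Type) (mu : distr T) (f : T -> R) : R :=
  \sum_(w <- mu) w.1 * f w.2.

Definition possible (T : eqType) (mu : distr T) (x : T) : Prop :=
  exists2 p : R, 0 < p & (p, x) \in mu.

End FiniteDistributions.

Section Algorithm.
Variables (R : realFieldType) (m n : nat).
Variables (c s : R) (d : 'I_m -> 'I_n -> R).

(* The load vector l_1, ..., l_n together with the accumulated cost G. *)
Definition state : Type := ({ffun 'I_n -> R} * R)%type.
Definition load (st : state) : {ffun 'I_n -> R} := st.1.
Definition total_cost (st : state) : R := st.2.

Definition init : state := ([ffun => 0], 0).

Definition available (st : state) : {set 'I_n} :=
  [set j | load st j + s <= c].

Definition assign (st : state) (i : 'I_m) (j : 'I_n) : state :=
  ([ffun k => if k == j then load st k + s else load st k],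
   total_cost st + s * d i j).

Definition round (st : state) : distr R state :=
  dbind (duniform R [set: 'I_m]) (fun i =>
  dbind (duniform R (available st)) (fun j =>
  dret R (assign st i j))).

Fixpoint run (t : nat) : distr R state :=
  if t is t'.+1 then dbind (run t') round else dret R init.

(* Whatever the random choices in the preceding rounds, each of the r requests
   finds a consumer with enough space. *)
Definition requests_assignable (r : nat) : Prop :=
  forall t : nat, (t < r)%N ->
  forall st : state, possible (run t) st -> available st != set0.

Definition mean_distance : R :=
  (m%:R * n%:R)^-1 * \sum_(i < m) \sum_(j < n) d i j.

End Algorithm.

Section Normalization.
Variable R : realFieldType.

Lemma expectation_ret (T : Type) (x : T) f :
  expectation (dret R x) f = f x.
Proof. by rewrite /expectation big_seq1 mul1r. Qed.

Lemma expectation_bind (T U : Type) (mu : distr R T) (nu : T -> distr R U) f :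
  expectation (dbind mu nu) f =
  expectation mu (fun x => expectation (nu x) f).
Proof.
rewrite /expectation /dbind big_flatten /= big_map; apply: eq_bigr => w _.
by rewrite big_map mulr_sumr; apply: eq_bigr => v _; rewrite mulrA.
Qed.

Lemma expectation_uniform (T : finType) (A : {set T}) f :
  expectation (duniform R A) f = #|A|%:R^-1 * \sum_(x in A) f x.
Proof. by rewrite /expectation big_map /= -mulr_sumr big_enum. Qed.

Lemma mass_uniform (T : finType) (A : {set T}) :
  A != set0 -> expectation (duniform R A) (fun=> 1) = 1.
Proof.
move=> A0; rewrite expectation_uniform sumr_const mulVf //.
by rewrite pnatr_eq0 cards_eq0.
Qed.

Variables (m n : nat) (c s : R) (d : 'I_m -> 'I_n -> R).

Lemma weight_run_ge0 (t : nat) w : w \in run c s d t -> 0 <= w.1.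
Proof.
elim: t w => [|t IH] w /=; first by rewrite inE => /eqP ->; exact: ler01.
case/flatten_mapP=> u /IH u0 /mapP[v + ->] /=.
case/flatten_mapP=> x /mapP[i _ ->] /mapP[y + ->] /=.
case/flatten_mapP=> z /mapP[j _ ->] /mapP[q + ->] /=.
by rewrite inE => /eqP -> /=; rewrite !mulr_ge0 ?invr_ge0 ?ler0n.
Qed.

Lemma mass_round (st : state R n) : (0 < m)%N -> available c s st != set0 ->
  expectation (round c s d st) (fun=> 1) = 1.
Proof.
move=> m0 st0; rewrite expectation_bind -[RHS](@mass_uniform _ [set: 'I_m]).
  rewrite !expectation_uniform; congr (_ * _); apply: eq_bigr => i _.
  rewrite expectation_bind -[RHS](mass_uniform st0) !expectation_uniform.
  by congr (_ * _); apply: eq_bigr => j _; rewrite expectation_ret.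
by rewrite -card_gt0 cardsT card_ord.
Qed.

Lemma total_mass_run (r : nat) : (0 < m)%N -> requests_assignable c s d r ->
  expectation (run c s d r) (fun=> 1) = 1.
Proof.
move=> m0; elim: r => [|r IH] ok; first by rewrite expectation_ret.
rewrite /= expectation_bind -[RHS]IH; last first.
  by move=> t tr; apply: ok; apply: ltnW.
rewrite {1}/expectation [RHS]/expectation big_seq [RHS]big_seq.
apply: eq_bigr => -[p st] w_in /=.
have := weight_run_ge0 w_in; rewrite le_eqVlt => /predU1P[/= <-|/= p0].
  by rewrite !mul0r.
by rewrite mass_round //; apply: (ok r) => //; exists p.
Qed.

End Normalization.

(* Main.v *)
Require Import Defs.
From HB Require Import structures.
From mathcomp Require Import all_boot all_order all_algebra.
From mathcomp Require Import perm.
Import Order.TTheory GRing.Theory Num.Theory.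
Local Open Scope ring_scope.

(** The load vector evolves independently of the producers and the distances,
    and its evolution commutes with every relabelling of the consumers. Hence
    in each round all consumers are selected with the same probability; as some
    consumer is always selected, this probability is 1/n. Although the choices
    made in different rounds are dependent, linearity of expectation then gives
    the expected cost [s * mean_distance d] in each round. *)

Lemma invn_mulrn (R : realFieldType) (x : R) (k : nat) :
  (0 < k)%N -> k%:R^-1 * (x *+ k) = x.
Proof. by move=> k0; rewrite -[x *+ k]mulr_natl mulKf // pnatr_eq0 -lt0n. Qed.

Section Expectation.
Variables (R : realFieldType) (T : Type) (mu : distr R T).

Lemma eq_expectation (f g : T -> R) :
  f =1 g -> expectation mu f = expectation mu g.
Proof. by move=> fg; apply: eq_bigr => w _; rewrite fg. Qed.

Lemma expectationD (f g : T -> R) :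
  expectation mu (fun x => f x + g x) = expectation mu f + expectation mu g.
Proof. by rewrite -big_split; apply: eq_bigr => w _; rewrite mulrDr. Qed.

Lemma expectationZ (a : R) (f : T -> R) :
  expectation mu (fun x => a * f x) = a * expectation mu f.
Proof. by rewrite mulr_sumr; apply: eq_bigr => w _; rewrite mulrCA. Qed.

Lemma expectation_sum (I : finType) (f : I -> T -> R) :
  expectation mu (fun x => \sum_i f i x) = \sum_i expectation mu (f i).
Proof. by rewrite exchange_big; apply: eq_bigr => w _; rewrite mulr_sumr. Qed.

End Expectation.

Section Loads.
Variables (R : realFieldType) (n : nat) (c s : R).
Implicit Types (l : {ffun 'I_n -> R}) (g : {ffun 'I_n -> R} -> R).

(* The cost component of a state is irrelevant to [available]. *)
Definition with_space l : {set 'I_n} := available c s (l, 0).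

Lemma availableE (st : state R n) : available c s st = with_space (load st).
Proof. by []. Qed.

Definition add_load l (j : 'I_n) : {ffun 'I_n -> R} :=
  [ffun k => if k == j then l k + s else l k].

Definition relabel (p : {perm 'I_n}) l : {ffun 'I_n -> R} :=
  [ffun k => l (p k)].

(** The transition operator of the Markov chain of load vectors, acting on an observable [g]. *)
Definition load_step g l : R :=
  #|with_space l|%:R^-1 * \sum_(j in with_space l) g (add_load l j).

Definition selection_prob (j : 'I_n) l : R :=
  if j \in with_space l then #|with_space l|%:R^-1 else 0.

Lemma mem_with_space_relabel p l j :
  (j \in with_space (relabel p l)) = (p j \in with_space l).
Proof. by rewrite !inE /load /= ffunE. Qed.

Lemma card_with_space_relabel p l :
  #|with_space (relabel p l)| = #|with_space l|.
Proof.
rewrite -[RHS](card_preimset _ (@perm_inj _ p)); apply: eq_card => j.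
by rewrite mem_with_space_relabel [RHS]inE.
Qed.

Lemma add_load_relabel p l j :
  add_load (relabel p l) j = relabel p (add_load l (p j)).
Proof. by apply/ffunP => k; rewrite !ffunE (inj_eq perm_inj). Qed.

(** The permutation [p] maps the consumers with space under [relabel p l] bijectively onto those
    with space under [l], so it preserves the uniform choice; reindexing the sum along [p] does the
    rest. *)
Lemma load_step_relabel p g l :
  load_step (g \o relabel p) l = load_step g (relabel p l).
Proof.
rewrite /load_step card_with_space_relabel; congr (_ * _).
rewrite (reindex_inj (@perm_inj _ p)) /=; apply: eq_big => [j|j _].
  by rewrite mem_with_space_relabel.
by rewrite add_load_relabel.
Qed.

Lemma selection_prob_relabel p j l :
  selection_prob j (relabel p l) = selection_prob (p j) l.
Proof.
by rewrite /selection_prob mem_with_space_relabel card_with_space_relabel.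
Qed.

Lemma sum_selection_prob l :
  with_space l != set0 -> \sum_j selection_prob j l = 1.
Proof.
move=> l0; rewrite /selection_prob -big_mkcond sumr_const.
rewrite -[_^-1 *+ _]mulr_natl divff //.
by rewrite pnatr_eq0 cards_eq0.
Qed.

End Loads.

Arguments relabel {R n}.
Arguments load_step {R n}.
Arguments selection_prob {R n}.

Section Run.
Variables (R : realFieldType) (m n : nat) (c s : R) (d : 'I_m -> 'I_n -> R).
Hypothesis m_gt0 : (0 < m)%N.

(** Entries of weight zero contribute nothing, and all other weights are positive. This lets
    assignability, which concerns possible states only, be used under an expectation. *)
Lemma eq_expectation_run (t : nat) (f g : state R n -> R) :
  (forall st, possible (run c s d t) st -> f st = g st) ->
  expectation (run c s d t) f = expectation (run c s d t) g.
Proof.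
move=> fg; rewrite /expectation big_seq [RHS]big_seq.
apply: eq_bigr => -[p st] w_in /=.
have := weight_run_ge0 w_in; rewrite le_eqVlt => /predU1P[/= <-|/= p0].
  by rewrite !mul0r.
by rewrite fg //; exists p.
Qed.

Lemma expectation_roundE (st : state R n) (f : state R n -> R) :
  expectation (round c s d st) f =
  m%:R^-1 * \sum_i (#|available c s st|%:R^-1 *
    \sum_(j in available c s st) f (assign s d st i j)).
Proof.
rewrite expectation_bind expectation_uniform cardsT card_ord.
congr (_ * _); apply: eq_big => [i|i _]; first by rewrite inE.
rewrite expectation_bind expectation_uniform; congr (_ * _).
by apply: eq_bigr => j _; rewrite expectation_ret.
Qed.

(** The new loads do not depend on the producer, so averaging over producers changes nothing.
    Without an available consumer both sides are 0. *)
Lemma expectation_round_load (st : state R n) (g : {ffun 'I_n -> R} -> R) :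
  expectation (round c s d st) (fun st' => g (load st')) =
  load_step c s g (load st).
Proof.
rewrite expectation_roundE (eq_bigr (fun=> load_step c s g (load st))) //.
by rewrite sumr_const card_ord invn_mulrn.
Qed.

Lemma expectation_run_relabel (t : nat) (p : {perm 'I_n})
    (g : {ffun 'I_n -> R} -> R) :
  expectation (run c s d t) (fun st => g (relabel p (load st))) =
  expectation (run c s d t) (fun st => g (load st)).
Proof.
elim: t g => [|t IH] g /=.
  rewrite !expectation_ret; congr g; apply/ffunP => k.
  by rewrite !ffunE.
rewrite !expectation_bind.
under eq_expectation do
  rewrite (expectation_round_load _ (g \o relabel p)) load_step_relabel.
under [RHS]eq_expectation do rewrite expectation_round_load.
(* The hypothesis is used for the observable [load_step c s g], which is why the induction keeps [g]
   general. *)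
exact: IH.
Qed.

Lemma expectation_selection_prob (r t : nat) (j : 'I_n) :
  requests_assignable c s d r -> (t < r)%N ->
  expectation (run c s d t) (fun st => selection_prob c s j (load st)) =
  n%:R^-1.
Proof.
move=> ok tr; set E := fun k =>
  expectation (run c s d t) (fun st => selection_prob c s k (load st)).
have E_const k : E k = E j.
  (* The transposition of [j] and [k] turns selection of [k] into selection of [j]. *)
  rewrite /E -(expectation_run_relabel t (tperm j k)).
  by apply: eq_expectation => st; rewrite selection_prob_relabel tpermR.
have n0 : (0 < n)%N by apply: leq_ltn_trans (ltn_ord j).
have : \sum_k E k = 1.
  (* Reading 1 as the total mass of the run makes both sides expectations, to be compared on
     possible states. *)
  rewrite -expectation_sum -(@total_mass_run R m n c s d t m_gt0); last first.
    by move=> u ut; apply: ok; apply: ltn_trans tr.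
  by apply: eq_expectation_run => st /(ok t tr); apply: sum_selection_prob.
under eq_bigr do rewrite E_const.
rewrite sumr_const card_ord => nE.
by rewrite -/(E j) -[LHS](invn_mulrn _ _ n n0) nE mulr1.
Qed.

(** Given the state, producer and consumer are independent, so each consumer's share of the expected
    increment factors into a mean over producers and a selection probability. *)
Lemma expectation_round_cost (st : state R n) : available c s st != set0 ->
  expectation (round c s d st) (@total_cost R n) =
  total_cost st + s * \sum_j ((m%:R^-1 * \sum_i d i j) *
                              selection_prob c s j (load st)).
Proof.
move=> st0; rewrite expectation_roundE.
under eq_bigr do rewrite /= big_split sumr_const -mulr_sumr mulrDr /=.
rewrite big_split mulrDr /=; congr (_ + _).
  (* The earlier cost is constant over the round, and its averages over two nonempty sets return
     it. *)
  by rewrite sumr_const card_ord !invn_mulrn ?card_gt0.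
rewrite /selection_prob -availableE.
under [in RHS]eq_bigr do rewrite -mulrA mulr_suml.
rewrite -[in RHS]mulr_sumr exchange_big [RHS]mulrCA; congr (_ * _).
rewrite mulr_sumr.
apply: eq_bigr => i _; rewrite mulrCA big_mkcond; congr (_ * _).
rewrite mulr_sumr.
by apply: eq_bigr => j _; case: ifP => _; rewrite ?mulr0 // mulrC.
Qed.

Lemma expectation_run_cost (r t : nat) :
  requests_assignable c s d r -> (t <= r)%N ->
  expectation (run c s d t) (@total_cost R n) = s * mean_distance d *+ t.
Proof.
move=> ok; elim: t => [|t IH] tr; first by rewrite expectation_ret mulr0n.
rewrite /= expectation_bind.
rewrite (eq_expectation_run t _ _
  (fun st st_possible => expectation_round_cost st (ok t tr st st_possible))).
rewrite expectationD (IH (ltnW tr)) mulrSr expectationZ; congr (_ + _ * _).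
rewrite expectation_sum.
under eq_bigr do rewrite expectationZ (expectation_selection_prob r) //.
rewrite -mulr_suml -mulr_sumr exchange_big /mean_distance invfM.
by rewrite mulrAC.
Qed.

End Run.

Theorem theorem3 (R : realFieldType) (m n r : nat) (c s : R)
    (d : 'I_m -> 'I_n -> R)
    (m_gt0 : (0 < m)%N) (n_gt0 : (0 < n)%N)
    (d_ge0 : forall (i : 'I_m) (j : 'I_n), 0 <= d i j)
    (assignable : requests_assignable c s d r) :
  expectation (run c s d r) (@total_cost R n) =
  \sum_(1 <= t < r.+1) s * mean_distance d.
Proof.
(* The range from 1 to [r] has exactly [r] equal terms. *)
rewrite sumr_const_nat subn1.
exact: expectation_run_cost m_gt0 _ _ assignable (leqnn r).
Qed.
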